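(* Let $f,\psi:\mathbb R^p\to\mathbb R$ be directionally differentiable (not necessarily smooth or convex), let $\beta^{(0)}\in\mathbb R^p$ be arbitrary, and let the sequence $\beta^{(t)}$ satisfy $$\beta^{(t+1)}\in\mathop{\arg\min}_{\beta\in\mathbb R^p}\ \{f(\beta)+\mathbf\Delta_\psi(\beta,\beta^{(t)})\},\qquad t\ge 0 .$$ Then for all $T\ge 1$, $$\mathop{\mathrm{avg}}_{0\le t\le T}\,(2\bar{\mathbf\Delta}_\psi+\mathbf\Delta_f)(\beta^{(t)},\beta^{(t+1)})\ \le\ \frac{1}{T+1}\big[f(\beta^{(0)})-f(\beta^{(T+1)})\big].$$
   Context: For $\psi:\mathbb R^p\to\mathbb R$, the one-sided directional derivative is $\delta\psi(\beta;h)=\lim_{\epsilon\to0+}[\psi(\beta+\epsilon h)-\psi(\beta)]/\epsilon$; $\psi$ is called directionally differentiable if this limit exists and is finite for all $\beta,h$. The generalized Bregman function is $\mathbf\Delta_\psi(\beta,\gamma)=\psi(\beta)-\psi(\gamma)-\delta\psi(\gamma;\beta-\gamma)$, and its symmetrization is $\bar{\mathbf\Delta}_\psi(\beta,\gamma)=\frac12\{\mathbf\Delta_\psi(\beta,\gamma)+\mathbf\Delta_\psi(\gamma,\beta)\}$. Linear combinations such as $2\bar{\mathbf\Delta}_\psi+\mathbf\Delta_f$ are evaluated pointwise. $\mathrm{avg}_{0\le t\le T}a_t=\frac1{T+1}\sum_{t=0}^Ta_t$. *)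

(* Defs.v *)
From mathcomp Require Import all_boot all_order all_algebra.
From mathcomp Require Import all_classical all_reals all_analysis.

Set Implicit Arguments.
Unset Strict Implicit.
Unset Printing Implicit Defensive.

Import Order.TTheory GRing.Theory Num.Theory.
Import numFieldNormedType.Exports.

Local Open Scope classical_set_scope.
Local Open Scope ring_scope.

Definition dirquot (R : realType) (p : nat) (psi : 'cV[R]_p -> R)
    (b h : 'cV[R]_p) (e : R) : R :=
  (psi (b + e *: h) - psi b) / e.

(* [lim] is total; it is the actual limit whenever [dirdifferentiable psi]. *)
Definition dirderiv (R : realType) (p : nat) (psi : 'cV[R]_p -> R)
    (b h : 'cV[R]_p) : R :=
  lim (dirquot psi b h e @[e --> 0^'+]).

(* Convergence is in [R], not in [\bar R], so the limit is finite. *)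
Definition dirdifferentiable (R : realType) (p : nat)
    (psi : 'cV[R]_p -> R) : Prop :=
  forall b h : 'cV[R]_p, cvg (dirquot psi b h e @[e --> 0^'+]).

Definition bregman (R : realType) (p : nat) (psi : 'cV[R]_p -> R)
    (b g : 'cV[R]_p) : R :=
  psi b - psi g - dirderiv psi g (b - g).

Definition sym_bregman (R : realType) (p : nat) (psi : 'cV[R]_p -> R)
    (b g : 'cV[R]_p) : R :=
  2^-1 * (bregman psi b g + bregman psi g b).

Definition argmin (R : realType) (p : nat) (F : 'cV[R]_p -> R) :
    set 'cV[R]_p :=
  [set b | forall b' : 'cV[R]_p, F b <= F b'].

Definition avg (R : realType) (T : nat) (a : nat -> R) : R :=
  T.+1%:R^-1 * \sum_(0 <= t < T.+1) a t.

(* Main.v *)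
(** For convex combinations [c + e (b - c)] of two consecutive iterates
    [b = beta t] and [c = beta t.+1], positive homogeneity of
    [dirderiv psi b] gives [dirderiv psi b ((1 - e) (c - b)) =
    (1 - e) dirderiv psi b (c - b)], so the linearization term of the surrogate
    has slope exactly [dirderiv psi b (c - b)] at [e = 0]. First-order optimality
    of [c] in the direction [b - c] then reads
    [0 <= df(c; b - c) + dpsi(c; b - c) + dpsi(b; c - b)], which is the one-step
    bound, and the one-step bounds telescope. *)
Require Import Defs.
From mathcomp Require Import all_boot all_order all_algebra.
From mathcomp Require Import all_classical all_reals all_analysis.
From mathcomp Require Import lra.

Set Implicit Arguments.
Unset Strict Implicit.
Unset Printing Implicit Defensive.

Import Order.TTheory GRing.Theory Num.Theory.
Import numFieldNormedType.Exports.

Local Open Scope classical_set_scope.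
Local Open Scope ring_scope.

Lemma cvg_mulr_right0 (R : realType) (k : R) :
  0 < k -> k * e @[e --> 0^'+] --> 0^'+.
Proof.
move=> k0 P; rewrite /at_right /= => -[d /= d0 dP].
exists (d / k) => /=; first exact: divr_gt0.
move=> e /=; rewrite sub0r normrN => ed e0; apply: dP; last exact: mulr_gt0.
by rewrite /= sub0r normrN normrM gtr0_norm // mulrC -ltr_pdivlMr.
Qed.

(** The quotient along [k *: h] at [e] is [k] times the quotient along [h] at [k * e], and [k * e]
    tends to [0^'+] with [e]. *)
Lemma dirderivZ (R : realType) (p : nat) (psi : 'cV[R]_p -> R)
    (b h : 'cV[R]_p) (k : R) :
  cvg (dirquot psi b h e @[e --> 0^'+]) -> 0 < k ->
  dirderiv psi b (k *: h) = k * dirderiv psi b h.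
Proof.
move=> psi_bh k0; apply/cvg_lim => //.
have -> : dirquot psi b (k *: h) = fun e => k * dirquot psi b h (k * e).
  apply/funext => e; rewrite /dirquot scalerA [e * k]mulrC invfM.
  by rewrite mulrCA [k * (_ * _)]mulrA divff ?gt_eqF// mul1r.
apply: cvgMl_tmp.
exact: (cvg_comp _ _ (cvg_mulr_right0 k0) psi_bh).
Qed.

Lemma argmin_bregman_first_order (R : realType) (p : nat)
    (f psi : 'cV[R]_p -> R) (b c : 'cV[R]_p) :
  dirdifferentiable f -> dirdifferentiable psi ->
  argmin (fun x => f x + bregman psi x b) c ->
  0 <= dirderiv f c (b - c) + dirderiv psi c (b - c) + dirderiv psi b (c - b).
Proof.
move=> f_dd psi_dd cmin; rewrite -(opprK (dirderiv psi b _)) subr_ge0.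
(* The bound is free of [e], so it is enough to prove it for the sum of quotients at small [e]. *)
apply: (cvgr_to_ge (cvgD (f_dd c (b - c)) (psi_dd c (b - c)))).
near=> e.
have e0 : 0 < e by near: e; exact: nbhs_right_gt.
have e1 : 0 < 1 - e.
  by rewrite subr_gt0; near: e; exact: nbhs_right_lt.
have := cmin (c + e *: (b - c)).
have -> : f (c + e *: (b - c)) + bregman psi (c + e *: (b - c)) b =
    f (c + e *: (b - c)) + (psi (c + e *: (b - c)) - psi b
      - (1 - e) * dirderiv psi b (c - b)).
  rewrite -dirderivZ//; congr (_ + (_ - dirderiv _ _ _)).
  by rewrite scalerBl scale1r -(opprB c b) scalerN addrAC.
rewrite /bregman /= !fctE /dirquot -mulrDl ler_pdivlMr// => ?.
lra.
Unshelve. all: by end_near.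
Qed.

Theorem theorem2 (R : realType) (p : nat) (f psi : 'cV[R]_p -> R)
    (beta : nat -> 'cV[R]_p)
    (f_dd : dirdifferentiable f) (psi_dd : dirdifferentiable psi)
    (beta_argmin : forall t : nat,
      argmin (fun b : 'cV[R]_p => f b + bregman psi b (beta t)) (beta t.+1)) :
  forall T : nat, (1 <= T)%N ->
    avg T (fun t : nat => 2 * sym_bregman psi (beta t) (beta t.+1)
                          + bregman f (beta t) (beta t.+1))
    <= T.+1%:R^-1 * (f (beta 0%N) - f (beta T.+1)).
Proof.
move=> T _; rewrite /avg ler_wpM2l ?invr_ge0//.
rewrite -[leRHS]opprB -(telescope_sumr (f \o beta)) // -sumrN.
apply: ler_sum => t _.
have := argmin_bregman_first_order f_dd psi_dd (beta_argmin t).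
(* The values of [psi] cancel in the symmetrization; only its two slopes remain. *)
rewrite /sym_bregman /bregman /=; lra.
Qed.
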